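(* Let $(M,g)$ be a co-screen (proper) QGCR-lightlike submanifold of an indefinite nearly $\mu$-Sasakian manifold $(\overline{M},\overline{\phi},\xi,\eta,\overline{g})$, with decomposition $TM=D\oplus\overline{D}$. If $D$ is nearly auto-parallel, then for all $X,Y\in\Gamma(D)$ the section $h(X,\overline{\phi}Y)+h(Y,\phi_1X)$ of $\mathrm{tr}(TM)$ has no component in $\mathcal{L}\perp\mathcal{S}$.
   Context: Ambient manifold. An indefinite almost contact metric manifold $(\overline{M},\overline{\phi},\xi,\eta,\overline{g})$ is an odd-dimensional manifold with a $(1,1)$-tensor $\overline{\phi}$, a vector field $\xi$, a 1-form $\eta$ and a semi-Riemannian metric $\overline{g}$ with $\overline{\phi}^2=-\mathbb{I}+\eta\otimes\xi$, $\eta(\xi)=1$, $\eta\circ\overline{\phi}=0$, $\overline{\phi}\xi=0$, $\overline{g}(\overline{\phi}X,\overline{\phi}Y)=\overline{g}(X,Y)-\eta(X)\eta(Y)$, $\eta(X)=\overline{g}(\xi,X)$. With $\overline{\nabla}$ the Levi-Civita connection of $\overline{g}$ and $\mu$ a real constant, it is indefinite nearly $\mu$-Sasakian if $(\overline{\nabla}_X\overline{\phi})Y+(\overline{\nabla}_Y\overline{\phi})X=\mu\{2\overline{g}(X,Y)\xi-\eta(Y)X-\eta(X)Y\}$ for all vector fields $X,Y$ on $\overline{M}$. Lightlike submanifolds. $M$ is a submanifold of $\overline{M}$ with induced (degenerate) metric $g$ such that $\mathrm{Rad}\,TM=TM\cap TM^\perp$ is a smooth distribution of rank $r>0$. $S(TM)$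 is a chosen non-degenerate complement of $\mathrm{Rad}\,TM$ in $TM$, and $S(TM^\perp)$ a chosen non-degenerate complement of $\mathrm{Rad}\,TM$ in $TM^\perp$. For a local basis $\{E_i\}$ of $\mathrm{Rad}\,TM$ there are local sections $\{N_i\}$ of the orthogonal complement of $S(TM^\perp)$ in $S(TM)^\perp$ with $\overline{g}(E_i,N_j)=\delta_{ij}$, $\overline{g}(N_i,N_j)=0$; they span the lightlike transversal bundle $l\mathrm{tr}(TM)$. Put $\mathrm{tr}(TM)=l\mathrm{tr}(TM)\perp S(TM^\perp)$, so $T\overline{M}|_M=TM\oplus\mathrm{tr}(TM)$. For $X,Y\in\Gamma(TM)$ write $\overline{\nabla}_XY=\nabla_XY+h(X,Y)$ with $\nabla_XY\in\Gamma(TM)$ and $h(X,Y)\in\Gamma(\mathrm{tr}(TM))$. QGCR-lightlike. $(M,g,S(TM),S(TM^\perp))$ is quasi generalized CR (QGCR)-lightlike if: (i) there are distributions $D_1,D_2$ of $\mathrm{Rad}\,TM$ with $\mathrm{Rad}\,TM=D_1\oplus D_2$, $\overline{\phi}D_1=D_1$, $\overline{\phi}D_2\subset S(TM)$; (ii) there are vector subbundles $D_0,\overline{D}$ of $S(TM)$ with $S(TM)=\{\overline{\phi}D_2\oplus\overline{D}\}\perp D_0$, $\overline{\phi}D_0\subseteq D_0$, $\overline{D}=\overline{\phi}\mathcal{S}\oplus\overline{\phi}\mathcal{L}$, where $D_0$ is non-degenerate and $\mathcal{L}$, $\mathcal{S}$ are vector subbundles of $l\mathrm{tr}(TM)$ and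 $S(TM^\perp)$ respectively. It is proper if $D_1,D_0,D_2,\mathcal{S}$ are all nonzero; QGCR-lightlike submanifolds are assumed proper. Co-screen: $\xi\in\Gamma(S(TM^\perp))$ along $M$. In this case $TM=D\oplus\overline{D}$ with $D=\mathrm{Rad}\,TM\perp D_0\perp\overline{\phi}D_2$, $\overline{\phi}\,\overline{D}=\mathcal{S}\perp\mathcal{L}$, and $\mathrm{tr}(TM)=\overline{\phi}\,\overline{D}\perp\mathcal{G}\perp\mathbb{R}\xi$ with $\overline{\phi}\mathcal{G}=\mathcal{G}$. ''No component in $\mathcal{L}\perp\mathcal{S}$'' means zero projection onto $\mathcal{L}\perp\mathcal{S}=\overline{\phi}\,\overline{D}$ in this last decomposition. For $X\in\Gamma(TM)$ write $\overline{\phi}X=\phi_1X+\varphi_1X$ with $\phi_1X\in\Gamma(TM)$, $\varphi_1X\in\Gamma(\mathrm{tr}(TM))$. A distribution $D$ on $M$ is nearly auto-parallel if $\nabla_XY+\nabla_YX\in\Gamma(D)$ for all $X,Y\in\Gamma(D)$. *)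

(* Defs.v *)
From HB Require Import structures.
From mathcomp Require Import all_boot all_order all_algebra.
From mathcomp Require Import all_classical all_reals all_analysis.

Set Implicit Arguments.
Unset Strict Implicit.
Unset Printing Implicit Defensive.

Import Order.TTheory GRing.Theory Num.Theory.
Import numFieldNormedType.Exports.

Local Open Scope classical_set_scope.
Local Open Scope ring_scope.

Fixpoint Ck (R : realType) (n k : nat) (U : set 'rV[R]_n)
    (f : 'rV[R]_n -> R^o) : Prop :=
  (forall x, U x -> {for x, continuous f}) /\
  match k with
  | 0 => True
  | k'.+1 => forall j : 'I_n,
      (forall x, U x -> derivable f x (delta_mx 0 j)) /\
      Ck k' U (fun x => 'D_(delta_mx 0 j) f x)
  end.

(* Only meant for open [U]. *)
Definition smooth_on (R : realType) (n : nat) (U : set 'rV[R]_n)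
    (f : 'rV[R]_n -> R^o) : Prop := forall k, Ck k U f.

Record chart (R : realType) (T : topologicalType) (n : nat) := Chart {
  dom : set T;
  coord : T -> 'rV[R]_n;
  coordV : 'rV[R]_n -> T;
  dom_open : open dom;
  img_open : open (coord @` dom);
  coordK : forall p, dom p -> coordV (coord p) = p;
  coord_continuous : forall p, dom p -> {for p, continuous coord};
  coordV_continuous :
    forall x, (coord @` dom) x -> {for x, continuous coordV} }.

Record manifold (R : realType) (n : nat) := Manifold {
  carrier :> topologicalType;
  atlas : set (chart R carrier n);
  carrier_hausdorff : hausdorff_space carrier;
  carrier_second_countable : @second_countable carrier;
  atlas_cover : forall p : carrier, exists2 c, atlas c & dom c p;
  atlas_compatible : forall c d, atlas c -> atlas d -> forall j : 'I_n,
    smooth_on (coord c @` (dom c `&` dom d))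
      (fun x => coord d (coordV c x) 0 j) }.

Definition smooth_fun (R : realType) (n : nat) (M : manifold R n)
    (f : M -> R^o) : Prop :=
  forall c, @atlas R n M c -> smooth_on (coord c @` dom c) (f \o coordV c).

Definition smooth_map (R : realType) (m n : nat) (M : manifold R m)
    (N : manifold R n) (i : M -> N) : Prop :=
  continuous i /\
  forall c d, @atlas R m M c -> @atlas R n N d -> forall j : 'I_n,
    smooth_on (coord c @` (dom c `&` i @^-1` dom d))
      (fun x => coord d (i (coordV c x)) 0 j).

(* Tangent vectors at all points live in this single vector space, as
   operators on real functions; [tangent p] carves out T_pM. *)
Definition vec (R : realType) (n : nat) (M : manifold R n) : lmodType R :=
  ((M -> R^o) -> R^o : lmodType R).

Definition field (R : realType) (n : nat) (M : manifold R n) : Type :=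
  M -> vec M.

(* Derivations of C^oo(M) at p; the value on non-smooth functions is fixed to
   0, so that equality of operators is equality of tangent vectors. *)
Definition tangent (R : realType) (n : nat) (M : manifold R n) (p : M)
    : set (vec M) := [set v |
  [/\ forall (a : R) (f g : M -> R^o), smooth_fun f -> smooth_fun g ->
        v (fun q => a * f q + g q) = a * v f + v g,
      forall f g : M -> R^o, smooth_fun f -> smooth_fun g ->
        v (fun q => f q * g q) = v f * g p + f p * v g
    & forall f : M -> R^o, ~ smooth_fun f -> v f = 0 ] ].

Definition vector_field (R : realType) (n : nat) (M : manifold R n)
    (X : field M) : Prop :=
  (forall p, tangent p (X p)) /\
  (forall f : M -> R^o, smooth_fun f -> smooth_fun (fun p => X p f)).

Definition bracket (R : realType) (n : nat) (M : manifold R n)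
    (X Y : field M) : field M :=
  fun p (f : M -> R^o) => X p (fun q => Y q f) - Y p (fun q => X q f).

Definition tensor11 (R : realType) (n : nat) (M : manifold R n)
    (phi : M -> vec M -> vec M) : Prop :=
  [/\ forall p v, tangent p v -> tangent p (phi p v),
      forall p (a : R) v w, tangent p v -> tangent p w ->
        phi p (a *: v + w) = a *: phi p v + phi p w
    & forall X, vector_field X -> vector_field (fun p => phi p (X p)) ].

Definition one_form (R : realType) (n : nat) (M : manifold R n)
    (eta : M -> vec M -> R^o) : Prop :=
  (forall p (a : R) v w, tangent p v -> tangent p w ->
     eta p (a *: v + w) = a * eta p v + eta p w) /\
  (forall X, vector_field X -> smooth_fun (fun p => eta p (X p))).

Definition neg_def_dim (R : realType) (n : nat) (M : manifold R n)
    (g : M -> vec M -> vec M -> R^o) (p : M) (k : nat) : Prop :=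
  exists2 e : 'I_k -> vec M, (forall j, tangent p (e j)) &
    forall c : 'I_k -> R, (exists j, c j <> 0) ->
      g p (\sum_j c j *: e j) (\sum_j c j *: e j) < 0.

Definition metric_index (R : realType) (n : nat) (M : manifold R n)
    (g : M -> vec M -> vec M -> R^o) (p : M) (nu : nat) : Prop :=
  neg_def_dim g p nu /\ forall k, neg_def_dim g p k -> (k <= nu)%N.

Record semi_riemannian (R : realType) (n : nat) (M : manifold R n)
    (g : M -> vec M -> vec M -> R^o) : Prop := {
  metric_linear : forall p (a : R) u v w,
    tangent p u -> tangent p v -> tangent p w ->
    g p (a *: u + v) w = a * g p u w + g p v w;
  metric_sym : forall p v w, tangent p v -> tangent p w -> g p v w = g p w v;
  metric_nondegenerate : forall p v, tangent p v ->
    (forall w, tangent p w -> g p v w = 0) -> v = 0;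
  metric_smooth : forall X Y, vector_field X -> vector_field Y ->
    smooth_fun (fun p => g p (X p) (Y p));
  metric_constant_index : exists nu, forall p, metric_index g p nu }.

Record levi_civita (R : realType) (n : nat) (M : manifold R n)
    (g : M -> vec M -> vec M -> R^o)
    (nabla : field M -> field M -> field M) : Prop := {
  conn_field : forall X Y, vector_field X -> vector_field Y ->
    vector_field (nabla X Y);
  conn_linear_l : forall (f : M -> R^o) X X' Y, smooth_fun f ->
    vector_field X -> vector_field X' -> vector_field Y ->
    forall p, nabla (fun q => f q *: X q + X' q) Y p =
              f p *: nabla X Y p + nabla X' Y p;
  conn_add_r : forall X Y Y',
    vector_field X -> vector_field Y -> vector_field Y' ->
    forall p, nabla X (fun q => Y q + Y' q) p = nabla X Y p + nabla X Y' p;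
  conn_leibniz : forall (f : M -> R^o) X Y, smooth_fun f ->
    vector_field X -> vector_field Y ->
    forall p, nabla X (fun q => f q *: Y q) p =
              X p f *: Y p + f p *: nabla X Y p;
  conn_torsion_free : forall X Y, vector_field X -> vector_field Y ->
    forall p, nabla X Y p - nabla Y X p = bracket X Y p;
  conn_metric : forall X Y Z,
    vector_field X -> vector_field Y -> vector_field Z ->
    forall p, X p (fun q => g q (Y q) (Z q)) =
              g p (nabla X Y p) (Z p) + g p (Y p) (nabla X Z p) }.

Record almost_contact_metric (R : realType) (n : nat)
    (M : manifold R n.*2.+1) (phi : M -> vec M -> vec M) (xi : field M)
    (eta : M -> vec M -> R^o) (g : M -> vec M -> vec M -> R^o) : Prop := {
  acm_metric : semi_riemannian g;
  acm_phi : tensor11 phi;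
  acm_xi : vector_field xi;
  acm_eta : one_form eta;
  acm_phi2 : forall p v, tangent p v ->
    phi p (phi p v) = - v + eta p v *: xi p;
  acm_eta_xi : forall p, eta p (xi p) = 1;
  acm_eta_phi : forall p v, tangent p v -> eta p (phi p v) = 0;
  acm_phi_xi : forall p, phi p (xi p) = 0;
  acm_compatible : forall p v w, tangent p v -> tangent p w ->
    g p (phi p v) (phi p w) = g p v w - eta p v * eta p w;
  acm_eta_g : forall p v, tangent p v -> eta p v = g p (xi p) v }.

Definition cov_tensor11 (R : realType) (n : nat) (M : manifold R n)
    (nabla : field M -> field M -> field M) (phi : M -> vec M -> vec M)
    (X Y : field M) : field M :=
  fun p => nabla X (fun q => phi q (Y q)) p - phi p (nabla X Y p).

Record nearly_sasakian (R : realType) (n : nat) (M : manifold R n.*2.+1)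
    (phi : M -> vec M -> vec M) (xi : field M) (eta : M -> vec M -> R^o)
    (g : M -> vec M -> vec M -> R^o)
    (nabla : field M -> field M -> field M) (mu : R) : Prop := {
  ns_acm : almost_contact_metric phi xi eta g;
  ns_levi_civita : levi_civita g nabla;
  ns_equation : forall X Y, vector_field X -> vector_field Y -> forall p,
    cov_tensor11 nabla phi X Y p + cov_tensor11 nabla phi Y X p =
    mu *: ((2 * g p (X p) (Y p)) *: xi p
           - eta p (Y p) *: X p - eta p (X p) *: Y p) }.

Definition sumset (V : zmodType) (A B : set V) : set V :=
  [set v | exists a b, [/\ A a, B b & v = a + b] ].

Definition line (R : realType) (V : lmodType R) (u : V) : set V :=
  [set v | exists a : R, v = a *: u].

Definition dsum (V : zmodType) (C A B : set V) : Prop :=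
  C = sumset A B /\ (forall v, A v -> B v -> v = 0).

Definition odsum (R : realType) (V : zmodType) (b : V -> V -> R)
    (C A B : set V) : Prop :=
  dsum C A B /\ (forall v w, A v -> B w -> b v w = 0).

(* a is the projection of w on A along B; unique when A and B meet in 0. *)
Definition is_component (V : zmodType) (A B : set V) (w a : V) : Prop :=
  A a /\ exists2 b, B b & w = a + b.

Definition is_basis (R : realType) (V : lmodType R) (k : nat) (A : set V)
    (e : 'I_k -> V) : Prop :=
  (forall v, A v <-> exists c : 'I_k -> R, v = \sum_j c j *: e j) /\
  (forall c : 'I_k -> R, \sum_j c j *: e j = 0 -> forall j, c j = 0).

Definition tangent_map (R : realType) (m n : nat) (M : manifold R m)
    (N : manifold R n) (i : M -> N) (u : vec M) : vec N :=
  fun f : N -> R^o => if `[< smooth_fun f >] then u (f \o i) else 0.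

Definition submanifold (R : realType) (m n : nat) (M : manifold R m)
    (N : manifold R n) (i : M -> N) : Prop :=
  [/\ smooth_map i, injective i
    & forall p u, tangent p u -> tangent_map i u = 0 -> u = 0].

(* Vector fields along i, i.e. sections of the pullback of TN (the condition
   that they be tangent to N comes with smoothness, resp. with subbundles). *)
Definition field_along (R : realType) (m n : nat) (M : manifold R m)
    (N : manifold R n) (i : M -> N) : Type := M -> vec N.

Definition bundle_along (R : realType) (m n : nat) (M : manifold R m)
    (N : manifold R n) (i : M -> N) : Type := M -> set (vec N).

(* As i is an immersion, hence locally an embedding, a field along i is smooth
   near p iff it is the restriction of an ambient vector field near p; since
   ambient bump functions exist, the latter can be taken globally defined. *)
Definition extends_near (R : realType) (m n : nat) (M : manifold R m)
    (N : manifold R n) (i : M -> N) (p : M) (X : field_along i)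
    (Xt : field N) : Prop :=
  vector_field Xt /\ \forall q \near p, X q = Xt (i q).
Arguments extends_near {R m n M N} i p X Xt.

Definition smooth_near (R : realType) (m n : nat) (M : manifold R m)
    (N : manifold R n) (i : M -> N) (p : M) (X : field_along i) : Prop :=
  exists Xt, extends_near i p X Xt.
Arguments smooth_near {R m n M N} i p X.

Definition local_frame (R : realType) (m n k : nat) (M : manifold R m)
    (N : manifold R n) (i : M -> N) (p : M) (B : bundle_along i)
    (E : 'I_k -> field_along i) : Prop :=
  (forall j, smooth_near i p (E j)) /\
  \forall q \near p, is_basis (B q) (fun j => E j q).

Definition subbundle_rank (R : realType) (m n : nat) (M : manifold R m)
    (N : manifold R n) (i : M -> N) (B : bundle_along i) (k : nat) : Prop :=
  forall p, exists E : 'I_k -> field_along i, local_frame p B E.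

Definition subbundle (R : realType) (m n : nat) (M : manifold R m)
    (N : manifold R n) (i : M -> N) (B : bundle_along i) : Prop :=
  exists k, subbundle_rank B k.

Definition nonzero (R : realType) (m n : nat) (M : manifold R m)
    (N : manifold R n) (i : M -> N) (B : bundle_along i) : Prop :=
  exists p, exists2 v, B p v & v <> 0.

(* Gamma(B) *)
Definition sections (R : realType) (m n : nat) (M : manifold R m)
    (N : manifold R n) (i : M -> N) (B : bundle_along i)
    (X : field_along i) : Prop :=
  (forall p, B p (X p)) /\ (forall p, smooth_near i p X).

Definition bsum (R : realType) (m n : nat) (M : manifold R m)
    (N : manifold R n) (i : M -> N) (A B : bundle_along i)
    : bundle_along i := fun p => sumset (A p) (B p).

Definition bimage (R : realType) (m n : nat) (M : manifold R m)
    (N : manifold R n) (i : M -> N) (phi : N -> vec N -> vec N)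
    (B : bundle_along i) : bundle_along i := fun p => phi (i p) @` B p.

Definition TM (R : realType) (m n : nat) (M : manifold R m)
    (N : manifold R n) (i : M -> N) : bundle_along i :=
  fun p => tangent_map i @` tangent p.

Definition perp (R : realType) (m n : nat) (M : manifold R m)
    (N : manifold R n) (i : M -> N) (g : N -> vec N -> vec N -> R^o)
    (B : bundle_along i) : bundle_along i :=
  fun p => [set v | tangent (i p) v /\ forall w, B p w -> g (i p) v w = 0].

Definition Rad (R : realType) (m n : nat) (M : manifold R m)
    (N : manifold R n) (i : M -> N) (g : N -> vec N -> vec N -> R^o)
    : bundle_along i := fun p => TM i p `&` perp g (TM i) p.

Definition nondegenerate_bundle (R : realType) (m n : nat) (M : manifold R m)
    (N : manifold R n) (i : M -> N) (g : N -> vec N -> vec N -> R^o)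
    (B : bundle_along i) : Prop :=
  forall p v, B p v -> (forall w, B p w -> g (i p) v w = 0) -> v = 0.

Definition bundle_dsum (R : realType) (m n : nat) (M : manifold R m)
    (N : manifold R n) (i : M -> N) (C A B : bundle_along i) : Prop :=
  forall p, dsum (C p) (A p) (B p).

Definition bundle_odsum (R : realType) (m n : nat) (M : manifold R m)
    (N : manifold R n) (i : M -> N) (g : N -> vec N -> vec N -> R^o)
    (C A B : bundle_along i) : Prop :=
  forall p, odsum (g (i p)) (C p) (A p) (B p).

(* For a given screen STM and co-screen STMperp the lightlike transversal
   bundle is not unique, so it is part of the data. *)
Definition lightlike_transversal (R : realType) (m n r : nat)
    (M : manifold R m) (N : manifold R n) (i : M -> N)
    (g : N -> vec N -> vec N -> R^o) (STM STMperp ltr : bundle_along i)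
    : Prop :=
  forall p (E : 'I_r -> field_along i), local_frame p (Rad i g) E ->
  exists F : 'I_r -> field_along i, local_frame p ltr F /\
    \forall q \near p, forall j l : 'I_r,
      [/\ perp g STM q (F j q), perp g STMperp q (F j q),
          g (i q) (E j q) (F l q) = (j == l)%:R
        & g (i q) (F j q) (F l q) = 0].

Record lightlike_submanifold (R : realType) (m n r : nat)
    (M : manifold R m) (N : manifold R n) (i : M -> N)
    (g : N -> vec N -> vec N -> R^o)
    (STM STMperp ltr : bundle_along i) : Prop := {
  ll_submanifold : submanifold i;
  ll_rank_pos : (0 < r)%N;
  ll_Rad : subbundle_rank (Rad i g) r;
  ll_STM : subbundle STM;
  ll_STM_sum : bundle_odsum g (TM i) (Rad i g) STM;
  ll_STM_nondeg : nondegenerate_bundle g STM;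
  ll_STMperp : subbundle STMperp;
  ll_STMperp_sum : bundle_odsum g (perp g (TM i)) (Rad i g) STMperp;
  ll_STMperp_nondeg : nondegenerate_bundle g STMperp;
  ll_ltr : lightlike_transversal r g STM STMperp ltr }.

Record proper_QGCR (R : realType) (m n : nat) (M : manifold R m)
    (N : manifold R n) (i : M -> N) (phi : N -> vec N -> vec N)
    (g : N -> vec N -> vec N -> R^o) (STM STMperp ltr : bundle_along i)
    (D1 D2 D0 Dbar L S : bundle_along i) : Prop := {
  qgcr_D1 : subbundle D1;
  qgcr_D2 : subbundle D2;
  qgcr_Rad : bundle_dsum (Rad i g) D1 D2;
  qgcr_phi_D1 : forall p, bimage phi D1 p = D1 p;
  qgcr_phi_D2 : forall p, bimage phi D2 p `<=` STM p;
  qgcr_D0 : subbundle D0;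
  qgcr_Dbar : subbundle Dbar;
  qgcr_phiD2_Dbar :
    bundle_dsum (bsum (bimage phi D2) Dbar) (bimage phi D2) Dbar;
  qgcr_STM : bundle_odsum g STM (bsum (bimage phi D2) Dbar) D0;
  qgcr_D0_nondeg : nondegenerate_bundle g D0;
  qgcr_phi_D0 : forall p, bimage phi D0 p `<=` D0 p;
  qgcr_L : subbundle L;
  qgcr_S : subbundle S;
  qgcr_L_sub : forall p, L p `<=` ltr p;
  qgcr_S_sub : forall p, S p `<=` STMperp p;
  qgcr_Dbar_sum : bundle_dsum Dbar (bimage phi S) (bimage phi L);
  qgcr_proper : [/\ nonzero D1, nonzero D0, nonzero D2 & nonzero S] }.

Definition invariant_distribution (R : realType) (m n : nat)
    (M : manifold R m) (N : manifold R n) (i : M -> N)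
    (phi : N -> vec N -> vec N) (g : N -> vec N -> vec N -> R^o)
    (D0 D2 : bundle_along i) : bundle_along i :=
  bsum (bsum (Rad i g) D0) (bimage phi D2).

Definition xi_line (R : realType) (m n : nat) (M : manifold R m)
    (N : manifold R n) (i : M -> N) (xi : field N) : bundle_along i :=
  fun p => line (xi (i p)).

(* The decompositions that accompany the co-screen condition are part of the
   structure: G is a choice, and phi Dbar = S _|_ L (which amounts to eta = 0
   on S) does not follow from [cs_xi] alone. *)
Record co_screen (R : realType) (m n : nat) (M : manifold R m)
    (N : manifold R n) (i : M -> N) (phi : N -> vec N -> vec N)
    (xi : field N) (g : N -> vec N -> vec N -> R^o)
    (STMperp ltr D0 D2 Dbar L S G : bundle_along i) : Prop := {
  cs_xi : forall p, STMperp p (xi (i p));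
  cs_TM : bundle_dsum (TM i) (invariant_distribution phi g D0 D2) Dbar;
  cs_phi_Dbar : bundle_odsum g (bimage phi Dbar) S L;
  cs_G : subbundle G;
  cs_phi_Dbar_G :
    bundle_odsum g (bsum (bimage phi Dbar) G) (bimage phi Dbar) G;
  cs_tr : bundle_odsum g (bsum ltr STMperp)
            (bsum (bimage phi Dbar) G) (xi_line i xi);
  cs_phi_G : forall p, bimage phi G p = G p }.

(* nabla_X Y + h(X,Y) is the value of the ambient connection on X, Y, computed
   as usual from arbitrary local extensions of X and Y. *)
Definition gauss_formula (R : realType) (m n : nat) (M : manifold R m)
    (N : manifold R n) (i : M -> N)
    (nabla : field N -> field N -> field N) (tr : bundle_along i)
    (nablaM h : field_along i -> field_along i -> field_along i) : Prop :=
  forall X Y : field_along i, sections (TM i) X -> sections (TM i) Y ->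
  [/\ sections (TM i) (nablaM X Y), sections tr (h X Y)
    & forall p Xt Yt, extends_near i p X Xt -> extends_near i p Y Yt ->
        nabla Xt Yt (i p) = nablaM X Y p + h X Y p].

Definition phi_decomposition (R : realType) (m n : nat) (M : manifold R m)
    (N : manifold R n) (i : M -> N) (phi : N -> vec N -> vec N)
    (tr : bundle_along i)
    (phi1 varphi1 : field_along i -> field_along i) : Prop :=
  forall X : field_along i, sections (TM i) X ->
  [/\ sections (TM i) (phi1 X), sections tr (varphi1 X)
    & forall p, phi (i p) (X p) = phi1 X p + varphi1 X p].

Definition nearly_auto_parallel (R : realType) (m n : nat)
    (M : manifold R m) (N : manifold R n) (i : M -> N)
    (nablaM : field_along i -> field_along i -> field_along i)
    (D : bundle_along i) : Prop :=
  forall X Y : field_along i, sections D X -> sections D Y ->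
    sections D (fun p => nablaM X Y p + nablaM Y X p).

(* Main.v *)
(* Since [xi] is normal to M, eta vanishes on TM and phi preserves D, so that
   phi_1 X = phi X on D.  For X, Y in D, the nearly mu-Sasakian identity and
   the Gauss formula give
     nabla_X phi Y + nabla_Y phi X + h(X, phi Y) + h(Y, phi X)
       = phi (nabla_X Y + nabla_Y X) + phi (h(X, Y) + h(Y, X))
         + 2 mu g(X, Y) xi.
   The first term on the right is in D because D is nearly auto-parallel, and
   phi maps tr(TM) = phi Dbar + G + R xi into Dbar + G.  As TM meets tr(TM)
   in 0, comparing transversal parts puts h(X, phi Y) + h(Y, phi X) in
   G + R xi. *)
Require Import Defs.
From HB Require Import structures.
From mathcomp Require Import all_boot all_order all_algebra.
From mathcomp Require Import all_classical all_reals all_analysis.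
From mathcomp Require Import ring.

Set Implicit Arguments.
Unset Strict Implicit.
Unset Printing Implicit Defensive.

Import Order.TTheory GRing.Theory Num.Theory.
Import numFieldNormedType.Exports.

Local Open Scope classical_set_scope.
Local Open Scope ring_scope.

(** * Subspaces of a real vector space, their sums, and spans of bases *)

Definition subspace (R : realType) (V : lmodType R) (A : set V) : Prop :=
  A 0 /\ forall (a : R) u v, A u -> A v -> A (a *: u + v).

Section Subspace.
Context (R : realType) (V : lmodType R).
Implicit Types (A B : set V) (u v : V).

Lemma subspace0 A : subspace A -> A 0.
Proof. by case. Qed.

Lemma subspaceD A u v : subspace A -> A u -> A v -> A (u + v).
Proof. by move=> [_ hA] Au Av; rewrite -[u]scale1r; exact: hA. Qed.

Lemma subspaceZ A (a : R) u : subspace A -> A u -> A (a *: u).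
Proof. by move=> [A0 hA] Au; rewrite -[_ *: _]addr0; exact: hA. Qed.

Lemma subspaceN A u : subspace A -> A u -> A (- u).
Proof. by move=> hA Au; rewrite -scaleN1r; exact: subspaceZ. Qed.

Lemma subspaceB A u v : subspace A -> A u -> A v -> A (u - v).
Proof. by move=> hA Au Av; apply: subspaceD => //; exact: subspaceN. Qed.

Lemma subspace_sum A (I : finType) (u : I -> V) :
  subspace A -> (forall j, A (u j)) -> A (\sum_j u j).
Proof.
move=> hA Au; apply: (big_ind A) => //; first exact: subspace0.
by move=> x y Ax Ay; exact: subspaceD.
Qed.

Lemma subspace_sumset A B : subspace A -> subspace B -> subspace (sumset A B).
Proof.
move=> hA hB; split.
  by exists 0, 0; rewrite addr0; split => //; exact: subspace0.
move=> a _ _ [u1 [u2 [Au1 Bu2 ->]]] [v1 [v2 [Av1 Bv2 ->]]].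
exists (a *: u1 + v1), (a *: u2 + v2); split; [exact: hA.2|exact: hB.2|].
by rewrite scalerDr addrACA.
Qed.

Lemma sumsetl A B u : subspace B -> A u -> sumset A B u.
Proof. by move=> [B0 _] Au; exists u, 0; rewrite addr0. Qed.

Lemma sumsetr A B u : subspace A -> B u -> sumset A B u.
Proof. by move=> [A0 _] Bu; exists 0, u; rewrite add0r. Qed.

Lemma subspace_basis k A (e : 'I_k -> V) : is_basis A e -> subspace A.
Proof.
move=> [hA _]; split.
  by apply/hA; exists (fun=> 0); rewrite big1// => j _; rewrite scale0r.
move=> a u v /hA[c ->] /hA[d ->]; apply/hA; exists (fun j => a * c j + d j).
rewrite scaler_sumr -big_split /=; apply: eq_bigr => j _.
by rewrite scalerDl scalerA.
Qed.

Lemma basis_mem k A (e : 'I_k -> V) j : is_basis A e -> A (e j).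
Proof.
move=> [hA _]; apply/hA; exists (fun l => (l == j)%:R).
rewrite (bigD1 j)//= eqxx scale1r big1 ?addr0// => l /negPf->.
by rewrite scale0r.
Qed.

End Subspace.

(** * Tangent spaces and the fibres of bundles along [i] *)

Lemma subspace_tangent (R : realType) (n : nat) (N : manifold R n) (p : N) :
  subspace (tangent p).
Proof.
split.
  split=> [a f f' _ _|f f' _ _|f _] /=; by rewrite ?mulr0 ?mul0r ?addr0.
move=> a u v [u1 u2 u3] [v1 v2 v3].
have E (w : N -> R^o) : (a *: u + v) w = a * u w + v w by [].
split => [b f f' sf sf'|f f' sf sf'|f nf].
- by rewrite !E u1// v1//; ring.
- by rewrite !E u2// v2//; ring.
- by rewrite E u3// v3// mulr0 addr0.
Qed.

Section Along.
Context (R : realType) (m n : nat) (M : manifold R m) (N : manifold R n).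
Context (i : M -> N).
Implicit Types (A B : bundle_along i) (p : M).

Lemma local_frame_basis k p B (E : 'I_k -> field_along i) :
  local_frame p B E -> is_basis (B p) (E^~ p).
Proof. by move=> [_ /nbhs_singleton]. Qed.

(** The fibres of a bundle are mere sets of operators; tangency comes from the smoothness of the
    frame, whose members agree at [p] with ambient vector fields. *)
Lemma local_frame_tangent k p B (E : 'I_k -> field_along i) v :
  local_frame p B E -> B p v -> tangent (i p) v.
Proof.
move=> hE; have [hb _] := local_frame_basis hE; case: hE => sE _.
move=> /hb[c ->]; apply: subspace_sum; first exact: subspace_tangent.
move=> j; apply: subspaceZ; first exact: subspace_tangent.
have [Xt [[tX _] /nbhs_singleton ->]] := sE j; exact: tX.
Qed.

Lemma subbundle_subspace B p : subbundle B -> subspace (B p).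
Proof. by move=> [k /(_ p)[E /local_frame_basis]]; exact: subspace_basis. Qed.

Lemma subbundle_tangent B p v : subbundle B -> B p v -> tangent (i p) v.
Proof. by move=> [k /(_ p)[E]]; exact: local_frame_tangent. Qed.

Lemma sections_sub A B X :
  (forall p, A p `<=` B p) -> sections A X -> sections B X.
Proof. by move=> AB [hA ?]; split => // p; exact: AB. Qed.

End Along.

(** * Lightlike submanifolds: TM and tr(TM) meet in 0 *)

Section Lightlike.
Context (R : realType) (m n r : nat) (M : manifold R m) (N : manifold R n).
Context (i : M -> N) (g : N -> vec N -> vec N -> R^o).
Context (STM STMperp ltr : bundle_along i).
Context (hg : semi_riemannian g).
Context (hl : lightlike_submanifold r g STM STMperp ltr).

Lemma Rad_subbundle : subbundle (Rad i g).
Proof. by exists r; exact: ll_Rad hl. Qed.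

(** Read off the splitting TM = Rad TM + S(TM) into subbundles, without studying the differential of
    [i]; tangency to the ambient manifold is obtained below in the same way. *)
Lemma TM_subspace p : subspace (TM i p).
Proof.
have [[-> _] _] := ll_STM_sum hl p.
by apply: subspace_sumset; apply: subbundle_subspace;
  [exact: Rad_subbundle | exact: ll_STM hl].
Qed.

Lemma TM_tangent p v : TM i p v -> tangent (i p) v.
Proof.
have [[-> _] _] := ll_STM_sum hl p; move=> [a [b [Ra Sb ->]]].
apply: subspaceD; first exact: subspace_tangent.
- exact: subbundle_tangent Rad_subbundle Ra.
- exact: subbundle_tangent (ll_STM hl) Sb.
Qed.

Lemma STMperp_perp p v : STMperp p v -> perp g (TM i) p v.
Proof.
have [[-> _] _] := ll_STMperp_sum hl p => Sv.
exact: sumsetr (subbundle_subspace _ Rad_subbundle) Sv.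
Qed.

(** Frames of [ltr] are given only as duals of frames of the radical, so a frame of Rad TM at [p] is
    chosen first. *)
Lemma ltr_subspace_tangent p :
  subspace (ltr p) /\ (forall v, ltr p v -> tangent (i p) v).
Proof.
have [E hE] := ll_Rad hl p.
have [F [hF _]] := ll_ltr hl hE.
split; first exact: subspace_basis (local_frame_basis hF).
by move=> v; exact: local_frame_tangent hF.
Qed.

Lemma tr_subspace p : subspace (bsum ltr STMperp p).
Proof.
apply: subspace_sumset; first exact: (ltr_subspace_tangent p).1.
exact: subbundle_subspace (ll_STMperp hl).
Qed.

Lemma tr_tangent p v : bsum ltr STMperp p v -> tangent (i p) v.
Proof.
move=> [a [b [la Sb ->]]]; apply: subspaceD; first exact: subspace_tangent.
- exact: (ltr_subspace_tangent p).2.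
- exact: (STMperp_perp Sb).1.
Qed.

Lemma metric_suml (I : finType) p (c : I -> R) (e : I -> vec N) w :
  (forall j, tangent p (e j)) -> tangent p w ->
  g p (\sum_j c j *: e j) w = \sum_j c j * g p (e j) w.
Proof.
move=> te tw.
have g0 : g p 0 w = 0.
  have t0 := subspace0 (subspace_tangent p).
  have := metric_linear hg (-1) t0 t0 tw.
  by rewrite scaler0 addr0 mulN1r addNr.
(* [g] is linear on tangent vectors only, so the induction also carries the tangency of the partial
   sums. *)
have gl (s : seq I) : g p (\sum_(j <- s) c j *: e j) w =
    \sum_(j <- s) c j * g p (e j) w /\ tangent p (\sum_(j <- s) c j *: e j).
  elim: s => [|j s [IH tI]].
    by rewrite !big_nil; split => //; exact: subspace0 (subspace_tangent p).
  rewrite !big_cons; split.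
    by rewrite (metric_linear hg)// IH.
  by apply: (subspace_tangent p).2.
exact: (gl _).1.
Qed.

(* Pairing with a frame of the radical kills the ltr(TM)-part of a tangent
   vector; what is left lies in [S(TM^perp)] and in [Rad TM]. *)
Lemma TM_tr_disjoint p v : TM i p v -> bsum ltr STMperp p v -> v = 0.
Proof.
move=> Tv [f [s [lf Ss vfs]]].
have [E hE] := ll_Rad hl p.
have [F [hF /nbhs_singleton hEF]] := ll_ltr hl hE.
have bF := local_frame_basis hF.
have RE l : Rad i g p (E l p) := basis_mem l (local_frame_basis hE).
have tF j : tangent (i p) (F j p).
  by apply: (ltr_subspace_tangent p).2; exact: basis_mem bF.
have tE l : tangent (i p) (E l p) := (RE l).2.1.
have tf : tangent (i p) f := (ltr_subspace_tangent p).2 _ lf.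
have [ts hs] := STMperp_perp Ss.
(* [E l p] is normal to the tangent vector [v] and tangent, hence orthogonal to [s]; so it is
   orthogonal to f = v - s. *)
have fE l : g (i p) f (E l p) = 0.
  have := metric_linear hg 1 tf ts (tE l).
  rewrite scale1r -vfs mul1r (hs _ (RE l).1) addr0 => <-.
  by rewrite (Defs.metric_sym hg)//; [exact: (RE l).2.2 | exact: TM_tangent].
suff f0 : f = 0.
  move: vfs; rewrite f0 add0r => vs; rewrite vs.
  have [[_ RS0] _] := ll_STMperp_sum hl p; apply: RS0 => //; split.
    by rewrite -vs.
  exact: STMperp_perp.
(* By duality of the two frames, pairing with [E j p] isolates the coefficient [c j], which is
   therefore 0. *)
have [c fc] := (bF.1 f).1 lf.
rewrite fc big1// => j _.
have := fE j; rewrite fc metric_suml// (bigD1 j)//= big1 => [|l lj].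
  have [_ _ gEF _] := hEF j j.
  by rewrite (Defs.metric_sym hg)// gEF eqxx mulr1 addr0 => ->; rewrite scale0r.
have [_ _ gEF _] := hEF j l.
by rewrite (Defs.metric_sym hg)// gEF eq_sym (negPf lj) mulr0.
Qed.

End Lightlike.

(** * Action of [phi] on D, on [Dbar] and on tr(TM) *)

Section CoScreen.
Context (R : realType) (n m r : nat).
Context (Mbar : manifold R n.*2.+1) (M : manifold R m) (i : M -> Mbar).
Context (phi : Mbar -> vec Mbar -> vec Mbar) (xi : field Mbar).
Context (eta : Mbar -> vec Mbar -> R^o).
Context (g : Mbar -> vec Mbar -> vec Mbar -> R^o).
Context (STM STMperp ltr D1 D2 D0 Dbar L S G : bundle_along i).
Context (hc : almost_contact_metric phi xi eta g).
Context (hlightlike : lightlike_submanifold r g STM STMperp ltr).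
Context (hQGCR : proper_QGCR phi g STM STMperp ltr D1 D2 D0 Dbar L S).
Context (hcoscreen : co_screen phi xi g STMperp ltr D0 D2 Dbar L S G).
Local Notation D := (invariant_distribution phi g D0 D2).

Lemma phiD p v w : tangent p v -> tangent p w ->
  phi p (v + w) = phi p v + phi p w.
Proof.
case: (acm_phi hc) => _ phiL _ tv tw.
by rewrite -[v]scale1r phiL// !scale1r.
Qed.

Lemma phi_tangent p v : tangent p v -> tangent p (phi p v).
Proof. by case: (acm_phi hc) => + _ _; exact. Qed.

(** eta = g(xi, .), and [xi] lies in S(TM^perp), hence is normal to TM. *)
Lemma eta_TM p v : TM i p v -> eta (i p) v = 0.
Proof.
move=> Tv; rewrite (acm_eta_g hc); last exact: TM_tangent hlightlike _ _ Tv.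
exact: (STMperp_perp hlightlike (cs_xi hcoscreen p)).2.
Qed.

Lemma phi2_TM p v : TM i p v -> phi (i p) (phi (i p) v) = - v.
Proof.
move=> Tv; rewrite (acm_phi2 hc); last exact: TM_tangent hlightlike _ _ Tv.
by rewrite eta_TM// scale0r addr0.
Qed.

Lemma D_TM p v : D p v -> TM i p v.
Proof.
have [-> _] := cs_TM hcoscreen p => Dv.
exact: sumsetl (subbundle_subspace _ (qgcr_Dbar hQGCR)) Dv.
Qed.

Lemma phi0 p : phi p 0 = 0.
Proof.
have t0 := subspace0 (subspace_tangent p).
have := phiD t0 t0; rewrite addr0 -{1}[phi p 0]addr0.
by move/addrI.
Qed.

Lemma Dbar_TM p v : Dbar p v -> TM i p v.
Proof.
have [-> _] := cs_TM hcoscreen p => Dv; exists 0, v; rewrite add0r.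
split=> //; exists 0, 0; rewrite addr0; split => //.
  exists 0, 0; rewrite addr0; split => //; apply: subspace0.
    exact: subbundle_subspace (Rad_subbundle hlightlike).
  exact: subbundle_subspace (qgcr_D0 hQGCR).
exists 0; last exact: phi0.
exact: subspace0 (subbundle_subspace _ (qgcr_D2 hQGCR)).
Qed.

(** [phi] preserves [D1] and [D0] and exchanges [D2] with phi D2, since phi^2 = -1 on TM. *)
Lemma phi_D p v : D p v -> D p (phi (i p) v).
Proof.
have hR := subbundle_subspace p (Rad_subbundle hlightlike).
have [RadE _] := qgcr_Rad hQGCR p.
move=> [_ [_ [[a [b [Ra Db ->]]] [c D2c <-] ->]]].
have Rc : Rad i g p c.
  rewrite RadE; apply: sumsetr => //.
  exact: subbundle_subspace (qgcr_D1 hQGCR).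
move: (Ra); rewrite {1}RadE => -[a1 [a2 [Da1 Da2 aE]]].
have tc := TM_tangent hlightlike Rc.1.
have ta1 := subbundle_tangent (qgcr_D1 hQGCR) Da1.
have ta2 := subbundle_tangent (qgcr_D2 hQGCR) Da2.
have ta : tangent (i p) a by exact: Ra.2.1.
have tb := subbundle_tangent (qgcr_D0 hQGCR) Db.
have tab := subspaceD (subspace_tangent _) ta tb.
rewrite !phiD//; last exact: phi_tangent.
rewrite (phi2_TM Rc.1) aE phiD//.
(* For v = a1 + a2 + b + phi c, the radical part of phi v is phi a1 - c, its [D0]-part is phi b, and
   its part in phi D2 is phi a2. *)
exists (phi (i p) a1 - c + phi (i p) b), (phi (i p) a2); split.
- exists (phi (i p) a1 - c), (phi (i p) b); split => //.
    apply: subspaceB => //.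
    rewrite RadE; apply: sumsetl.
      exact: subbundle_subspace (qgcr_D2 hQGCR).
    by rewrite -(qgcr_phi_D1 hQGCR p); exists a1.
  by apply: (qgcr_phi_D0 hQGCR); exists b.
- by exists a2.
- rewrite -!addrA; congr (_ + _).
  rewrite [RHS]addrC -!addrA [RHS]addrC -!addrA; congr (_ + _).
  by rewrite addrC.
Qed.

(* In tr(TM) = phi Dbar + G + R xi, [phi] sends [phi Dbar] back to [Dbar],
   preserves [G], and kills [xi]. *)
Lemma phi_tr p v : bsum ltr STMperp p v ->
  exists d c, [/\ Dbar p d, G p c & phi (i p) v = c - d].
Proof.
have [[-> _] _] := cs_tr hcoscreen p.
move=> [_ [_ [[_ [b [[d Dd <-] Gb ->]]] [a ->] ->]]].
have td : tangent (i p) d by exact: subbundle_tangent (qgcr_Dbar hQGCR) Dd.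
have tb : tangent (i p) b by exact: subbundle_tangent (cs_G hcoscreen) Gb.
have tx : tangent (i p) (xi (i p)) by exact: (acm_xi hc).1.
have tpd := phi_tangent td.
have ts := subspace_tangent (i p).
exists d, (phi (i p) b); split => //.
  by rewrite -(cs_phi_G hcoscreen p); exists b.
have tax := subspaceZ a ts tx.
rewrite !phiD//; last exact: subspaceD.
case: (acm_phi hc) => _ phiL _.
have -> : phi (i p) (a *: xi (i p)) = 0.
  have := phiL (i p) a _ _ tx (subspace0 ts).
  by rewrite addr0 phi0 addr0 (acm_phi_xi hc) scaler0.
by rewrite (phi2_TM (Dbar_TM Dd)) addr0 addrC.
Qed.

Lemma G_xi_tr p v : bsum G (xi_line i xi) p v -> bsum ltr STMperp p v.
Proof.
have [[-> _] _] := cs_tr hcoscreen p => -[c [x [Gc lx ->]]].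
exists c, x; split => //; exists 0, c; rewrite add0r; split => //.
exists 0; last exact: phi0.
exact: subspace0 (subbundle_subspace _ (qgcr_Dbar hQGCR)).
Qed.

Lemma phi_extends p X Xt : extends_near i p X Xt ->
  extends_near i p (fun q => phi (i q) (X q)) (fun q => phi q (Xt q)).
Proof.
case: (acm_phi hc) => _ _ phiF [vX eX]; split; first exact: phiF.
by apply: filterS eX => q ->.
Qed.

Lemma phi_sections X :
  sections D X -> sections D (fun q => phi (i q) (X q)).
Proof.
move=> [DX sX]; split=> p; first exact: phi_D.
by have [Xt eX] := sX p; exists (fun q => phi q (Xt q)); exact: phi_extends.
Qed.

(** phi X - phi1 X is tangent because [phi] preserves D, and transversal because it equals varphi1
    X. The equality is one of fields, so that it can be rewritten inside [h]. *)
Lemma phi1_eq (phi1 varphi1 : field_along i -> field_along i) X :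
  phi_decomposition phi (bsum ltr STMperp) phi1 varphi1 -> sections D X ->
  phi1 X = fun q => phi (i q) (X q).
Proof.
move=> hphi1 sX; have [sp1 sv pE] := hphi1 X (sections_sub D_TM sX).
apply/funext => q; apply/eqP; rewrite eq_sym -subr_eq0; apply/eqP.
apply: (TM_tr_disjoint (acm_metric hc) hlightlike).
  apply: subspaceB; first exact: TM_subspace hlightlike q.
    exact/D_TM/(phi_sections sX).1.
  exact: sp1.1.
by rewrite pE addrAC subrr add0r; exact: sv.1.
Qed.

End CoScreen.

(** * Comparison of the transversal parts *)

Theorem theorem5p9 (R : realType) (n m r : nat)
    (Mbar : manifold R n.*2.+1) (M : manifold R m) (i : M -> Mbar)
    (phi : Mbar -> vec Mbar -> vec Mbar) (xi : field Mbar)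
    (eta : Mbar -> vec Mbar -> R^o)
    (g : Mbar -> vec Mbar -> vec Mbar -> R^o)
    (nablabar : field Mbar -> field Mbar -> field Mbar) (mu : R)
    (STM STMperp ltr D1 D2 D0 Dbar L S G : bundle_along i)
    (nabla h : field_along i -> field_along i -> field_along i)
    (phi1 varphi1 : field_along i -> field_along i)
    (hambient : nearly_sasakian phi xi eta g nablabar mu)
    (hlightlike : lightlike_submanifold r g STM STMperp ltr)
    (hQGCR : proper_QGCR phi g STM STMperp ltr D1 D2 D0 Dbar L S)
    (hcoscreen : co_screen phi xi g STMperp ltr D0 D2 Dbar L S G)
    (hgauss : gauss_formula nablabar (bsum ltr STMperp) nabla h)
    (hphi1 : phi_decomposition phi (bsum ltr STMperp) phi1 varphi1)
    (hauto : nearly_auto_parallel nabla (invariant_distribution phi g D0 D2)) :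
  forall X Y : field_along i,
    sections (invariant_distribution phi g D0 D2) X ->
    sections (invariant_distribution phi g D0 D2) Y ->
    forall p,
      is_component (bsum L S p) (bsum G (xi_line i xi) p)
        (h X (fun q => phi (i q) (Y q)) p + h Y (phi1 X) p) 0.
Proof.
move=> X Y sX sY p.
have hc := ns_acm hambient.
have hD := D_TM hQGCR hcoscreen.
rewrite (phi1_eq hc hlightlike hQGCR hcoscreen hphi1 sX).
have spX := phi_sections hc hlightlike hQGCR hcoscreen sX.
have spY := phi_sections hc hlightlike hQGCR hcoscreen sY.
have [TX TY] := (sections_sub hD sX, sections_sub hD sY).
have [TpX TpY] := (sections_sub hD spX, sections_sub hD spY).
(* [nablabar] acts on ambient fields only, so [X] and [Y] are extended near [p]; applying [phi] to
   the extensions extends phi X and phi Y. *)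
have [[Xt eX] [Yt eY]] := (sX.2 p, sY.2 p).
have [epX epY] := (phi_extends hc eX, phi_extends hc eY).
have [n1 h1 gXY] := hgauss X Y TX TY.
have [n2 h2 gYX] := hgauss Y X TY TX.
have [n3 h3 gXpY] := hgauss X _ TX TpY.
have [n4 h4 gYpX] := hgauss Y _ TY TpX.
have := ns_equation hambient eX.1 eY.1 (i p).
rewrite /cov_tensor11 (gXY p _ _ eX eY) (gYX p _ _ eY eX).
rewrite (gXpY p _ _ eX epY) (gYpX p _ _ eY epX).
have -> : Xt (i p) = X p by rewrite -(nbhs_singleton eX.2).
have -> : Yt (i p) = Y p by rewrite -(nbhs_singleton eY.2).
(* As eta vanishes on [X] and [Y], only the [xi]-term of the nearly Sasakian identity survives. *)
rewrite (eta_TM hc hlightlike hcoscreen (TX.1 p)).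
rewrite (eta_TM hc hlightlike hcoscreen (TY.1 p)) !scale0r !subr0 scalerA.
have tn1 := TM_tangent hlightlike (n1.1 p).
have tn2 := TM_tangent hlightlike (n2.1 p).
have th1 := tr_tangent hlightlike (h1.1 p).
have th2 := tr_tangent hlightlike (h2.1 p).
rewrite !(phiD hc)//.
have [d1 [c1 [Dd1 Gc1 ->]]] := phi_tr hc hlightlike hQGCR hcoscreen (h1.1 p).
have [d2 [c2 [Dd2 Gc2 ->]]] := phi_tr hc hlightlike hQGCR hcoscreen (h2.1 p).
(* Near auto-parallelism controls only the symmetrized sum, so the two images are joined under one
   [phi] before D-invariance is applied. *)
have TZ : TM i p (phi (i p) (nabla X Y p) + phi (i p) (nabla Y X p)).
  rewrite -(phiD hc)//.
  apply/hD/(phi_D hc hlightlike hQGCR hcoscreen).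
  exact: (hauto X Y sX sY).1.
set a := _ * _; set w := h X _ p + _.
move: TZ (n3.1 p) (n4.1 p) (h3.1 p) (h4.1 p).
(* From here only linear algebra in the fibre at [p] remains, so the values of the fields become
   plain vectors. *)
rewrite /w; move: (phi (i p) (nabla X Y p)) (phi (i p) (nabla Y X p)).
move: (nabla X _ p) (nabla Y _ p) (h X _ p) (h Y _ p).
move=> A1 A2 H1 H2 z1 z2 TZ TA1 TA2 tH1 tH2 eqn.
have hG := subbundle_subspace p (cs_G hcoscreen).
have hT := TM_subspace hlightlike p.
have htr := tr_subspace hlightlike p.
have GK : bsum G (xi_line i xi) p ((c1 + c2) + a *: xi (i p)).
  by exists (c1 + c2), (a *: xi (i p)); split => //; [exact: subspaceD|exists a].
split.
  by apply: subspace0; apply: subspace_sumset; apply: subbundle_subspace;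
    [exact: qgcr_L hQGCR|exact: qgcr_S hQGCR].
(* The expected transversal part: the [G]-parts of phi h(X,Y) and phi h(Y,X), plus the [xi]-term. *)
exists ((c1 + c2) + a *: xi (i p)) => //; rewrite add0r.
apply/eqP; rewrite eq_sym -subr_eq0; apply/eqP.
apply: (TM_tr_disjoint (acm_metric hc) hlightlike).
  (* Solving [eqn] for the transversal terms writes the difference through tangent vectors; it is
     also transversal, hence 0. *)
  have -> : c1 + c2 + a *: xi (i p) - (H1 + H2) =
      (A1 + A2) - (z1 + z2) + (d1 + d2).
    (* Vectors are operators on functions, so the identity is checked at each [f], where [ring]
       applies in [R]. *)
    rewrite -eqn; apply/funext => f.
    have addE (u v : vec Mbar) : (u + v) f = u f + v f by [].
    have oppE (u : vec Mbar) : (- u) f = - u f by [].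
    by rewrite !(addE, oppE); ring.
  apply: (subspaceD hT).
    by apply: (subspaceB hT) TZ; exact: subspaceD hT TA1 TA2.
  by apply: (subspaceD hT); exact: (Dbar_TM hc hlightlike hQGCR hcoscreen).
apply: (subspaceB htr); last exact: subspaceD htr tH1 tH2.
exact: (G_xi_tr hc hQGCR hcoscreen GK).
Qed.
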